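(* Let $f,g:B_R\to\mathbb{O}$ be regular functions. Then $$\bigcup_{\alpha\in V(f\ast g)}\mathbb{S}_\alpha=\bigcup_{\alpha\in V(f)\cup V(g)}\mathbb{S}_\alpha,$$ or, equivalently, given any $\alpha\in\mathbb{O}$, $V(f\ast g)\cap\mathbb{S}_\alpha$ is non-empty if and only if $(V(f)\cup V(g))\cap\mathbb{S}_\alpha$ is non-empty. In particular, the zero set of $f\ast g$ is contained in the union of spheres $\bigcup_{\alpha\in V(f)\cup V(g)}\mathbb{S}_\alpha$.
   Context: $\mathbb{O}$ is the real alternative division algebra of octonions. $B_R$ is the open ball of $\mathbb{O}$ centered at the origin with radius $R\in(0,+\infty]$. A function $f:B_R\to\mathbb{O}$ is (slice) regular if it is given by a power series $f(w)=\sum_{i\ge 0} w^i a_i$ with coefficients $a_i\in\mathbb{O}$ on the right, converging in $B_R$. For regular $f=\sum_i w^ia_i$, $g=\sum_j w^jb_j$ on $B_R$, the product is the regular function $(f\ast g)(w)=\sum_k w^k\big(\sum_{i+j=k}a_ib_j\big)$. $V(f)\subset B_R$ is the zero set of $f$. $\mathbb{S}_\alpha=\{\mathrm{Re}(\alpha)+|\mathrm{Im}(\alpha)|\,I : I\in\mathbb{O},\ I^2=-1\}$ is the conjugacy class of $\alpha\in\mathbb{O}$. *)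

(* Defs.v *)
(* World: Stdlib reals with Coquelicot. *)
From Stdlib Require Import Reals ClassicalEpsilon Ensembles.
From Coquelicot Require Import Coquelicot.

Open Scope R_scope.

(** * Octonions, by Cayley-Dickson doubling of Coquelicot's complex numbers *)

Definition Quat : Type := (C * C)%type.
Definition Oct : Type := (Quat * Quat)%type.

Definition Quat_NormedModule : NormedModule R_AbsRing :=
  prod_NormedModule R_AbsRing C_R_NormedModule C_R_NormedModule.

(** Coquelicot's norm on a product is [sqrt (norm x ^ 2 + norm y ^ 2)], so the
    norm of this module is the Euclidean norm of the eight real coordinates
    (see [Onorm_euclidean]), and its topology is the usual one of R^8. *)
Definition Oct_NormedModule : NormedModule R_AbsRing :=
  prod_NormedModule R_AbsRing Quat_NormedModule Quat_NormedModule.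

Definition Ozero : Oct := @zero Oct_NormedModule.
Definition Oplus (x y : Oct) : Oct := @plus Oct_NormedModule x y.
Definition Oopp (x : Oct) : Oct := @opp Oct_NormedModule x.
Definition Oscal (t : R) (x : Oct) : Oct := @scal R_AbsRing Oct_NormedModule t x.
Definition Onorm (x : Oct) : R := @norm R_AbsRing Oct_NormedModule x.

Definition Qplus (p q : Quat) : Quat := @plus Quat_NormedModule p q.
Definition Qopp (p : Quat) : Quat := @opp Quat_NormedModule p.

Definition Qconj (p : Quat) : Quat := (Cconj (fst p), Copp (snd p)).

(** In both doublings, (a, b) (c, d) = (a c - d^* b, d a + b c^* ). *)
Definition Qmult (p q : Quat) : Quat :=
  (Cminus (Cmult (fst p) (fst q)) (Cmult (Cconj (snd q)) (snd p)),
   Cplus (Cmult (snd q) (fst p)) (Cmult (snd p) (Cconj (fst q)))).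

Definition Oconj (x : Oct) : Oct := (Qconj (fst x), Qopp (snd x)).

Definition Omult (x y : Oct) : Oct :=
  (Qplus (Qmult (fst x) (fst y)) (Qopp (Qmult (Qconj (snd y)) (snd x))),
   Qplus (Qmult (snd y) (fst x)) (Qmult (snd x) (Qconj (fst y)))).

Definition Oreal (t : R) : Oct := (((t, 0), (0, 0)), ((0, 0), (0, 0))).
Definition Oone : Oct := Oreal 1.

Definition ORe (x : Oct) : R := fst (fst (fst x)).
Definition OIm (x : Oct) : Oct := Oplus x (Oopp (Oreal (ORe x))).

Fixpoint Opow (x : Oct) (n : nat) : Oct :=
  match n with
  | 0%nat => Oone
  | S m => Omult x (Opow x m)
  end.

Lemma Onorm_euclidean (a b c d e f g h : R) :
  Onorm (((a, b), (c, d)), ((e, f), (g, h))) =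
  sqrt (a ^ 2 + b ^ 2 + c ^ 2 + d ^ 2 + e ^ 2 + f ^ 2 + g ^ 2 + h ^ 2).
Proof.
unfold Onorm.
do 3 (unfold norm; simpl; unfold prod_norm; simpl).
unfold norm; simpl; unfold abs; simpl.
rewrite !Rmult_1_r.
assert (HA : forall z, Rabs z * Rabs z = z * z)
  by (intros z; exact (eq_sym (Rsqr_abs z))).
assert (H0 : forall z, 0 <= z * z) by (intros z; exact (Rle_0_sqr z)).
rewrite !HA, !sqrt_sqrt; repeat apply Rplus_le_le_0_compat; auto.
f_equal; ring.
Qed.

(** * Regular functions *)

Definition ball_O (r : Rbar) : Ensemble Oct := fun w => Rbar_lt (Onorm w) r.

Definition power_series_at (a : nat -> Oct) (w l : Oct) : Prop :=
  @is_series R_AbsRing Oct_NormedModule (fun n => Omult (Opow w n) (a n)) l.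

(** Functions on the ball of radius [r] are represented by total functions of
    which only the values on the ball matter. *)
Definition expands_on (r : Rbar) (a : nat -> Oct) (f : Oct -> Oct) : Prop :=
  forall w : Oct, ball_O r w -> power_series_at a w (f w).

Definition regular_on (r : Rbar) (f : Oct -> Oct) : Prop :=
  exists a : nat -> Oct, expands_on r a f.

(** For [0 < r] the expansion of a regular function is unique, so that the
    epsilon below selects the coefficients of [f]. *)
Definition coefficients (r : Rbar) (f : Oct -> Oct) : nat -> Oct :=
  epsilon (inhabits (fun _ : nat => Ozero)) (fun a => expands_on r a f).

Definition convolution (a b : nat -> Oct) (k : nat) : Oct :=
  @sum_n Oct_NormedModule (fun i => Omult (a i) (b (k - i)%nat)) k.

Definition power_series_sum (a : nat -> Oct) (w : Oct) : Oct :=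
  epsilon (inhabits Ozero) (fun l => power_series_at a w l).

Definition star (r : Rbar) (f g : Oct -> Oct) : Oct -> Oct :=
  power_series_sum (convolution (coefficients r f) (coefficients r g)).

Definition zero_set (r : Rbar) (f : Oct -> Oct) : Ensemble Oct :=
  fun w => ball_O r w /\ f w = Ozero.

(** * Conjugacy classes *)

Definition sphere (alpha : Oct) : Ensemble Oct := fun w =>
  exists J : Oct, Omult J J = Oopp Oone /\
    w = Oplus (Oreal (ORe alpha)) (Oscal (Onorm (OIm alpha)) J).

Definition union_of_spheres (A : Ensemble Oct) : Ensemble Oct := fun w =>
  exists alpha : Oct, In Oct A alpha /\ In Oct (sphere alpha) w.

(* Main.v *)
(** Write [w = x + y J] with [J^2 = -1] and [z = x + i y]. By alternativity
    [w^n a_n = Re (z^n) a_n + J (Im (z^n) a_n)], so that [f w = P + J Q], where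
    [P = sum Re (z^n) a_n] and [Q = sum Im (z^n) a_n] depend only on the sphere of
    [w]. The pair [(P, Q)], seen as [P + iota Q] in the complexified octonions with
    [iota] central, is multiplicative for the star product, by Cauchy products.
    Moreover [P + J Q = 0] for some imaginary unit [J] if and only if the complex
    norm [|P|^2 - |Q|^2 + 2 iota <P, Q>] vanishes. This norm is multiplicative
    with values in the field of complex numbers, so it vanishes for [f * g] if and
    only if it vanishes for [f] or for [g]. *)

Require Import Defs.
From Stdlib Require Import Reals Ensembles Lra Lia ClassicalEpsilon.
From Coquelicot Require Import Coquelicot.

Lemma sum_n_pair {U V : AbelianMonoid} (a : nat -> prod_AbelianMonoid U V) (n : nat) :
  sum_n a n = (sum_n (fun k => fst (a k)) n, sum_n (fun k => snd (a k)) n).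
Proof.
induction n as [|n IH].
- rewrite !sum_O. apply surjective_pairing.
- rewrite !sum_Sn, IH. reflexivity.
Qed.

Lemma is_series_pair {U V : NormedModule R_AbsRing}
    (a : nat -> prod_NormedModule R_AbsRing U V)
    (l : prod_NormedModule R_AbsRing U V) :
  is_series a l <->
  is_series (fun n => fst (a n)) (fst l) /\ is_series (fun n => snd (a n)) (snd l).
Proof.
unfold is_series. split.
- intros H. split; apply (proj2 (filterlim_locally _ _)); intros eps;
    generalize (proj1 (filterlim_locally _ _) H eps);
    apply filter_imp; intros n Hn; rewrite (sum_n_pair a) in Hn; apply Hn.
- intros [H1 H2]. apply (proj2 (filterlim_locally _ _)). intros eps.
  generalize (filter_and _ _ (proj1 (filterlim_locally _ _) H1 eps)
                             (proj1 (filterlim_locally _ _) H2 eps)).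
  apply filter_imp. intros n Hn. rewrite (sum_n_pair a). exact Hn.
Qed.

(** Out of range, [Ocoord i] is the last coordinate and [Ounit i] is [0]. *)
Definition Ocoord (i : nat) (x : Oct) : R :=
  match i with
  | 0 => fst (fst (fst x)) | 1 => snd (fst (fst x))
  | 2 => fst (snd (fst x)) | 3 => snd (snd (fst x))
  | 4 => fst (fst (snd x)) | 5 => snd (fst (snd x))
  | 6 => fst (snd (snd x)) | _ => snd (snd (snd x))
  end%nat.

Definition Ounit (i : nat) : Oct :=
  let d j := if Nat.eqb i j then 1 else 0 in
  (((d 0%nat, d 1%nat), (d 2%nat, d 3%nat)), ((d 4%nat, d 5%nat), (d 6%nat, d 7%nat))).

Lemma Ocoord_Oplus i x y : Ocoord i (Oplus x y) = Ocoord i x + Ocoord i y.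
Proof. do 7 (destruct i as [|i]; [reflexivity|]). reflexivity. Qed.

Lemma Ocoord_Oscal i t x : Ocoord i (Oscal t x) = t * Ocoord i x.
Proof. do 7 (destruct i as [|i]; [reflexivity|]). reflexivity. Qed.

Lemma Ocoord_sum_n i (a : nat -> Oct) n :
  Ocoord i (@sum_n Oct_NormedModule a n) = sum_n (fun k => Ocoord i (a k)) n.
Proof.
induction n as [|n IH].
- now rewrite !sum_O.
- rewrite !sum_Sn, <- IH. apply Ocoord_Oplus.
Qed.

Lemma Oct_ext x y : (forall i, Ocoord i x = Ocoord i y) -> x = y.
Proof.
intros H.
generalize (H 0%nat) (H 1%nat) (H 2%nat) (H 3%nat) (H 4%nat) (H 5%nat) (H 6%nat) (H 7%nat).
destruct x as [[[? ?] [? ?]] [[? ?] [? ?]]], y as [[[? ?] [? ?]] [[? ?] [? ?]]].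
simpl. now intros -> -> -> -> -> -> -> ->.
Qed.

Lemma is_series_Oct (a : nat -> Oct) (l : Oct) :
  @is_series R_AbsRing Oct_NormedModule a l <->
  forall i, is_series (fun n => Ocoord i (a n)) (Ocoord i l).
Proof.
unfold Oct_NormedModule, Quat_NormedModule, C_R_NormedModule.
rewrite (is_series_pair a), (is_series_pair (fun n => fst (a n))),
  (is_series_pair (fun n => snd (a n))).
rewrite (is_series_pair (fun n => fst (fst (a n)))),
  (is_series_pair (fun n => snd (fst (a n)))),
  (is_series_pair (fun n => fst (snd (a n)))),
  (is_series_pair (fun n => snd (snd (a n)))).
split.
- intros H i. do 7 (destruct i as [|i]; [apply H|]). apply H.
- intros H.
  exact (conj (conj (conj (H 0%nat) (H 1%nat)) (conj (H 2%nat) (H 3%nat)))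
              (conj (conj (H 4%nat) (H 5%nat)) (conj (H 6%nat) (H 7%nat)))).
Qed.

Lemma is_series_Oct_unique (a : nat -> Oct) (l m : Oct) :
  @is_series R_AbsRing Oct_NormedModule a l ->
  @is_series R_AbsRing Oct_NormedModule a m -> l = m.
Proof.
apply (@filterlim_locally_unique nat R_AbsRing Oct_NormedModule eventually _).
Qed.

Lemma Ocoord_Omult i x y :
  Ocoord i (Omult x y) =
  sum_n (fun j => sum_n (fun l =>
    Ocoord i (Omult (Ounit j) (Ounit l)) * (Ocoord j x * Ocoord l y)) 7) 7.
Proof.
destruct x as [[[? ?] [? ?]] [[? ?] [? ?]]], y as [[[? ?] [? ?]] [[? ?] [? ?]]].
rewrite sum_n_Reals. cbn [sum_f_R0]. rewrite !sum_n_Reals. cbn [sum_f_R0].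
unfold Ounit.
do 7 (destruct i as [|i]; [cbn; ring|]). cbn; ring.
Qed.

Lemma is_series_sum_n (u : nat -> nat -> R) (l : nat -> R) (m : nat) :
  (forall j, is_series (u j) (l j)) ->
  is_series (fun n => sum_n (fun j => u j n) m) (sum_n l m).
Proof.
intros H. induction m as [|m IH].
- rewrite sum_O. eapply is_series_ext; [|exact (H 0%nat)].
  intros n. now rewrite sum_O.
- rewrite sum_Sn. eapply is_series_ext; [|exact (is_series_plus _ _ _ _ IH (H (S m)))].
  intros n. now rewrite sum_Sn.
Qed.

Lemma is_series_Omult_l (c : Oct) (a : nat -> Oct) (l : Oct) :
  @is_series R_AbsRing Oct_NormedModule a l ->
  @is_series R_AbsRing Oct_NormedModule (fun n => Omult c (a n)) (Omult c l).
Proof.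
rewrite 2!is_series_Oct. intros H i. rewrite Ocoord_Omult.
eapply is_series_ext; [intros n; symmetry; apply Ocoord_Omult|].
apply (is_series_sum_n (fun j n => _)). intros j.
apply (is_series_sum_n (fun l n => _)). intros k.
apply (@is_series_scal R_AbsRing R_NormedModule _ (fun n => _)), (@is_series_scal R_AbsRing R_NormedModule _ (fun n => _)), H.
Qed.

Definition Oabs_summable (a : nat -> Oct) : Prop :=
  forall i, ex_series (fun n => Rabs (Ocoord i (a n))).

Lemma Oabs_summable_is_series (a : nat -> Oct) :
  Oabs_summable a -> exists l, @is_series R_AbsRing Oct_NormedModule a l.
Proof.
intros H.
pose (s i := Series (fun n => Ocoord i (a n))).
exists (((s 0%nat, s 1%nat), (s 2%nat, s 3%nat)), ((s 4%nat, s 5%nat), (s 6%nat, s 7%nat))).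
apply is_series_Oct. intros i.
do 7 (destruct i as [|i]; [apply Series_correct, (ex_series_Rabs _ (H _))|]).
apply Series_correct, (ex_series_Rabs _ (H 7%nat)).
Qed.

Lemma is_series_Omult (a b : nat -> Oct) (la lb : Oct) :
  @is_series R_AbsRing Oct_NormedModule a la ->
  @is_series R_AbsRing Oct_NormedModule b lb ->
  Oabs_summable a -> Oabs_summable b ->
  @is_series R_AbsRing Oct_NormedModule (convolution a b) (Omult la lb).
Proof.
rewrite !is_series_Oct. intros Ha Hb Aa Ab i. rewrite Ocoord_Omult.
apply is_series_ext with (fun n => sum_n (fun j => sum_n (fun l =>
  Ocoord i (Omult (Ounit j) (Ounit l)) *
  sum_f_R0 (fun k => Ocoord j (a k) * Ocoord l (b (n - k)%nat)) n) 7) 7).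
- intros n. symmetry. unfold convolution. rewrite Ocoord_sum_n.
  erewrite (sum_n_ext _ _ n) by (intros k; apply Ocoord_Omult).
  rewrite sum_n_switch. apply sum_n_ext. intros j.
  rewrite sum_n_switch. apply sum_n_ext. intros l.
  rewrite <- sum_n_Reals. apply (sum_n_mult_l (K := R_Ring)).
- apply (is_series_sum_n (fun j n => _)). intros j.
  apply (is_series_sum_n (fun l n => _)). intros k.
  apply (@is_series_scal R_AbsRing R_NormedModule _ (fun n => _)).
  apply (is_series_mult (fun n => Ocoord j (a n)) (fun n => Ocoord k (b n))); auto.
Qed.

Lemma ex_series_coord_in_ball (r : Rbar) (a : nat -> Oct) (f : Oct -> Oct) (i : nat) (s : R) :
  expands_on r a f -> 0 <= s -> Rbar_lt s r ->
  ex_series (fun n => Rabs (Ocoord i (a n) * s ^ n)).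
Proof.
intros Hf Hs Hr. apply CV_disk_inside. rewrite Rabs_pos_eq by exact Hs.
destruct (Rbar_lt_dec s (CV_radius (fun n => Ocoord i (a n)))) as [|Hc]; [assumption|].
exfalso. apply Rbar_not_lt_le in Hc.
assert (exists t, s < t /\ Rbar_lt t r) as [t [Hst Htr]].
{ destruct r as [r| |]; simpl in *.
  - exists ((s + r) / 2). lra.
  - exists (s + 1). split; [lra|exact I].
  - contradiction. }
apply (CV_disk_outside (fun n => Ocoord i (a n)) t).
{ rewrite Rabs_pos_eq by lra. eapply Rbar_le_lt_trans; [exact Hc|exact Hst]. }
(* On the real axis the terms of the series are [t^n a_n]. *)
assert (Hpow : forall n, Opow (Oreal t) n = Oreal (t ^ n)).
{ induction n as [|n IH]; [reflexivity|]. cbn [Opow]. rewrite IH.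
  unfold Oreal. apply Oct_ext. intros j.
  do 7 (destruct j as [|j]; [cbn; ring|]). cbn; ring. }
assert (Hb : ball_O r (Oreal t)).
{ unfold ball_O, Oreal. rewrite Onorm_euclidean.
  replace (_ + _) with (t * t) by ring. rewrite sqrt_square by lra. exact Htr. }
apply ex_series_lim_0. exists (Ocoord i (f (Oreal t))).
eapply is_series_ext; [|exact (proj1 (is_series_Oct _ _) (Hf _ Hb) i)].
intros n. simpl. rewrite Hpow.
assert (E : Omult (Oreal (t ^ n)) (a n) = Oscal (t ^ n) (a n)).
{ apply Oct_ext. intros j. rewrite Ocoord_Oscal. unfold Oreal.
  destruct (a n) as [[[? ?] [? ?]] [[? ?] [? ?]]].
  do 7 (destruct j as [|j]; [cbn; ring|]). cbn; ring. }
rewrite E, Ocoord_Oscal. apply Rmult_comm.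
Qed.

Lemma Oabs_summable_scal (r : Rbar) (a : nat -> Oct) (f : Oct -> Oct) (s : R) (u : nat -> R) :
  expands_on r a f -> 0 <= s -> Rbar_lt s r -> (forall n, Rabs (u n) <= s ^ n) ->
  Oabs_summable (fun n => Oscal (u n) (a n)).
Proof.
intros Hf Hs Hr Hu i.
apply (ex_series_le (K := R_AbsRing) (V := R_CompleteNormedModule) _
         (fun n => Rabs (Ocoord i (a n) * s ^ n))).
- intros n. rewrite Ocoord_Oscal. change norm with Rabs. rewrite Rabs_Rabsolu.
  rewrite !Rabs_mult, Rmult_comm.
  apply Rmult_le_compat_l; [apply Rabs_pos|].
  rewrite (Rabs_pos_eq (s ^ n)) by now apply pow_le. apply Hu.
- exact (ex_series_coord_in_ball r a f i s Hf Hs Hr).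
Qed.

Ltac Odestruct x := destruct x as [[[? ?] [? ?]] [[? ?] [? ?]]].
Ltac Oring :=
  let i := fresh "i" in
  apply Oct_ext; intros i; unfold Oreal;
  do 7 (destruct i as [|i]; [cbn; ring|]); cbn; ring.

Lemma Omult_Oscal_l t x y : Omult (Oscal t x) y = Oscal t (Omult x y).
Proof. Odestruct x; Odestruct y. Oring. Qed.

Lemma Omult_Oscal_r t x y : Omult x (Oscal t y) = Oscal t (Omult x y).
Proof. Odestruct x; Odestruct y. Oring. Qed.

Lemma Omult_Oplus_l x y z : Omult (Oplus x y) z = Oplus (Omult x z) (Omult y z).
Proof. Odestruct x; Odestruct y; Odestruct z. Oring. Qed.

Lemma Omult_Oplus_r x y z : Omult x (Oplus y z) = Oplus (Omult x y) (Omult x z).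
Proof. Odestruct x; Odestruct y; Odestruct z. Oring. Qed.

Lemma Omult_Oreal_l t x : Omult (Oreal t) x = Oscal t x.
Proof. Odestruct x. Oring. Qed.

Lemma Omult_Oreal_r t x : Omult x (Oreal t) = Oscal t x.
Proof. Odestruct x. Oring. Qed.

Lemma Ocoord_Ozero i : Ocoord i Ozero = 0.
Proof. do 7 (destruct i as [|i]; [reflexivity|]). reflexivity. Qed.

Definition Odot (x y : Oct) : R := sum_f_R0 (fun i => Ocoord i x * Ocoord i y) 7.

Lemma Odot_pos x : 0 <= Odot x x.
Proof. apply cond_pos_sum. intros i. apply Rle_0_sqr. Qed.

Lemma Onorm_Odot x : Onorm x = sqrt (Odot x x).
Proof. Odestruct x. rewrite Onorm_euclidean. f_equal. unfold Odot. cbn. ring. Qed.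

Lemma Odot_eq0 x : Odot x x = 0 -> x = Ozero.
Proof.
intros H. apply Oct_ext. intros i.
assert (Hi : Ocoord i x * Ocoord i x <= Odot x x).
{ unfold Odot. cbn [sum_f_R0].
  generalize (Rle_0_sqr (Ocoord 0 x)) (Rle_0_sqr (Ocoord 1 x)) (Rle_0_sqr (Ocoord 2 x))
    (Rle_0_sqr (Ocoord 3 x)) (Rle_0_sqr (Ocoord 4 x)) (Rle_0_sqr (Ocoord 5 x))
    (Rle_0_sqr (Ocoord 6 x)) (Rle_0_sqr (Ocoord 7 x)).
  unfold Rsqr. intros.
  do 7 (destruct i as [|i]; [lra|]).
  change (Ocoord (S (S (S (S (S (S (S i))))))) x) with (Ocoord 7 x). lra. }
rewrite Ocoord_Ozero. nra.
Qed.

Definition imaginary_unit (J : Oct) : Prop := Omult J J = Oopp Oone.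

Lemma imaginary_unitE J : imaginary_unit J <-> ORe J = 0 /\ Odot J J = 1.
Proof.
assert (E : Omult J J = Oplus (Oscal (2 * ORe J) J) (Oreal (- Odot J J))).
{ unfold Odot. Odestruct J. Oring. }
assert (D : Odot J J = ORe J * ORe J + Odot (OIm J) (OIm J)).
{ unfold Odot. Odestruct J. cbn. ring. }
unfold imaginary_unit. rewrite E. split.
- intros H.
  assert (HR : 2 * ORe J * ORe J - Odot J J = -1).
  { apply (f_equal ORe) in H. Odestruct J. unfold Odot in *; cbn in *. lra. }
  assert (HI : forall i, (2 * ORe J) * Ocoord i (OIm J) = 0).
  { intros i. apply (f_equal (Ocoord i)) in H. revert H. unfold Odot.
    Odestruct J.
    do 7 (destruct i as [|i]; [cbn; lra|]). cbn; lra. }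
  destruct (Req_dec (ORe J) 0) as [H0|H0].
  + split; [exact H0|]. rewrite H0 in HR. lra.
  + exfalso.
    assert (Odot (OIm J) (OIm J) = 0).
    { unfold Odot.
      assert (Z : forall i, Ocoord i (OIm J) = 0) by (intros i; specialize (HI i); nra).
      cbn [sum_f_R0]. rewrite !Z. ring. }
    nra.
- intros [-> ->]. Odestruct J. Oring.
Qed.

(* For [B <> 0] the only candidate is [J = - A B^-1]. *)
Lemma stem_zeroP A B :
  (exists J, imaginary_unit J /\ Oplus A (Omult J B) = Ozero) <->
  Odot A A = Odot B B /\ Odot A B = 0.
Proof.
split.
- intros [J [HJ H]]. apply imaginary_unitE in HJ. destruct HJ as [HJ0 HJ1].
  assert (A = Oscal (-1) (Omult J B)) as ->.
  { apply Oct_ext. intros i. apply (f_equal (Ocoord i)) in H.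
    rewrite Ocoord_Oplus in H. rewrite Ocoord_Oscal.
    rewrite Ocoord_Ozero in H. lra. }
  split.
  + transitivity (Odot J J * Odot B B); [|rewrite HJ1; ring].
    unfold Odot. Odestruct J; Odestruct B. cbn. ring.
  + transitivity (- (ORe J * Odot B B)); [|rewrite HJ0; ring].
    unfold Odot. Odestruct J; Odestruct B. cbn. ring.
- intros [H1 H2].
  destruct (Req_dec (Odot B B) 0) as [H0|H0].
  + rewrite H0 in H1. apply Odot_eq0 in H0, H1. subst.
    exists (Ounit 1). split; [|unfold Ozero, zero; cbn; Oring].
    unfold imaginary_unit, Ounit. cbn [Nat.eqb]. Oring.
  + exists (Oscal (- / Odot B B) (Omult A (Oconj B))). split.
    * apply imaginary_unitE. split.
      -- transitivity (- / Odot B B * Odot A B); [|rewrite H2; ring].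
         generalize (- / Odot B B). intros t. unfold Odot.
         Odestruct A; Odestruct B. cbn. ring.
      -- transitivity ((/ Odot B B * / Odot B B) * (Odot A A * Odot B B)).
         ++ transitivity ((- / Odot B B) * (- / Odot B B) * (Odot A A * Odot B B)); [|ring].
            generalize (- / Odot B B). intros t. unfold Odot.
            Odestruct A; Odestruct B. cbn. ring.
         ++ rewrite H1. field. exact H0.
    * rewrite Omult_Oscal_l.
      assert (E : Omult (Omult A (Oconj B)) B = Oscal (Odot B B) A)
        by (unfold Odot; Odestruct A; Odestruct B; Oring).
      rewrite E. apply Oct_ext. intros i. rewrite Ocoord_Oplus, !Ocoord_Oscal.
      rewrite Ocoord_Ozero. field. exact H0.
Qed.

Lemma stem_norm_mult A B A' B' :
  let P := Oplus (Omult A A') (Oscal (-1) (Omult B B')) in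
  let Q := Oplus (Omult A B') (Omult B A') in
  Odot P P - Odot Q Q =
    (Odot A A - Odot B B) * (Odot A' A' - Odot B' B') - 4 * Odot A B * Odot A' B' /\
  Odot P Q =
    (Odot A A - Odot B B) * Odot A' B' + Odot A B * (Odot A' A' - Odot B' B').
Proof.
intros P Q. unfold P, Q, Odot.
Odestruct A; Odestruct B; Odestruct A'; Odestruct B'. cbn. split; ring.
Qed.

Definition sphere_point (z : C) (J : Oct) : Oct := Oplus (Oreal (Re z)) (Oscal (Im z) J).

Lemma Opow_sphere_point z J n :
  imaginary_unit J -> Opow (sphere_point z J) n = sphere_point (Cpow z n) J.
Proof.
intros HJ. induction n as [|n IH].
- unfold sphere_point. cbn [Opow Cpow]. unfold Oone. Odestruct J. Oring.
- cbn [Opow]. rewrite IH, Cpow_S. unfold sphere_point.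
  rewrite Omult_Oplus_l, Omult_Oplus_r, Omult_Oscal_l, Omult_Oplus_r, !Omult_Oreal_l,
    Omult_Oscal_r, HJ, Omult_Oreal_r.
  destruct z as [x y]. destruct (Cpow (x, y) n) as [u v]. unfold Oone. Odestruct J.
  Oring.
Qed.

Lemma Onorm_sphere_point z J : imaginary_unit J -> Onorm (sphere_point z J) = Cmod z.
Proof.
intros HJ. apply imaginary_unitE in HJ. destruct HJ as [H0 H1].
rewrite Onorm_Odot. unfold Cmod. f_equal.
transitivity (Re z * Re z + 2 * Re z * Im z * ORe J + Im z * Im z * Odot J J).
- unfold Odot, sphere_point. Odestruct J. cbn. ring.
- rewrite H0, H1. unfold Re, Im. ring.
Qed.

Lemma ORe_sphere_point z J : imaginary_unit J -> ORe (sphere_point z J) = Re z.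
Proof.
intros HJ. apply imaginary_unitE in HJ. destruct HJ as [H0 _].
transitivity (Re z + Im z * ORe J); [reflexivity|]. rewrite H0. ring.
Qed.

Lemma Onorm_OIm_sphere_point z J :
  imaginary_unit J -> 0 <= Im z -> Onorm (OIm (sphere_point z J)) = Im z.
Proof.
intros HJ Hz. rewrite <- (sqrt_square (Im z)) by exact Hz.
rewrite Onorm_Odot. f_equal.
apply imaginary_unitE in HJ. destruct HJ as [H0 H1].
transitivity (Im z * Im z * (Odot J J - ORe J * ORe J)).
- unfold Odot, sphere_point. Odestruct J. cbn. ring.
- rewrite H0, H1. ring.
Qed.

Definition Oct_slice (x : Oct) : C := (ORe x, Onorm (OIm x)).

Lemma sphereE alpha w :
  sphere alpha w <-> exists J, imaginary_unit J /\ w = sphere_point (Oct_slice alpha) J.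
Proof. reflexivity. Qed.

Lemma Oct_slice_sphere alpha w : sphere alpha w -> Oct_slice w = Oct_slice alpha.
Proof.
rewrite sphereE. intros [J [HJ ->]]. unfold Oct_slice at 1.
rewrite ORe_sphere_point, Onorm_OIm_sphere_point by (try apply norm_ge_0; exact HJ).
reflexivity.
Qed.

Lemma sphere_refl w : sphere w w.
Proof.
apply sphereE.
assert (E : w = Oplus (Oreal (ORe w)) (OIm w)) by (Odestruct w; Oring).
destruct (Req_dec (Odot (OIm w) (OIm w)) 0) as [H0|H0].
- exists (Ounit 1). split; [unfold imaginary_unit, Ounit; cbn [Nat.eqb]; Oring|].
  unfold sphere_point, Oct_slice. cbn [Re Im fst snd]. rewrite Onorm_Odot, H0, sqrt_0.
  rewrite E at 1. rewrite (Odot_eq0 _ H0). unfold Ozero, zero; cbn. Oring.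
- assert (Hn : Onorm (OIm w) <> 0).
  { rewrite Onorm_Odot. intros H. apply H0, sqrt_eq_0; [apply Odot_pos|exact H]. }
  assert (Hs : Onorm (OIm w) * Onorm (OIm w) = Odot (OIm w) (OIm w))
    by (rewrite Onorm_Odot; apply sqrt_sqrt, Odot_pos).
  exists (Oscal (/ Onorm (OIm w)) (OIm w)). split.
  + apply imaginary_unitE. split.
    * transitivity (/ Onorm (OIm w) * ORe (OIm w)); [reflexivity|].
      unfold OIm at 2. Odestruct w. cbn. ring.
    * transitivity (/ Onorm (OIm w) * / Onorm (OIm w) * Odot (OIm w) (OIm w)).
      -- generalize (/ Onorm (OIm w)). intros t. generalize (OIm w). intros x.
         unfold Odot. Odestruct x. cbn. ring.
      -- rewrite <- Hs. field. exact Hn.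
  + rewrite E at 1. unfold sphere_point, Oct_slice. cbn [Re Im fst snd]. f_equal.
    apply Oct_ext. intros i. rewrite !Ocoord_Oscal. field. exact Hn.
Qed.

Lemma sphere_sym alpha w : sphere alpha w -> sphere w alpha.
Proof.
intros H. generalize (sphere_refl alpha). rewrite (sphereE alpha alpha), (sphereE w alpha).
now rewrite (Oct_slice_sphere _ _ H).
Qed.

Lemma Onorm_sphere alpha w : sphere alpha w -> Onorm w = Cmod (Oct_slice alpha).
Proof.
rewrite sphereE. intros [J [HJ ->]]. now apply Onorm_sphere_point.
Qed.

Definition stem_series (a : nat -> Oct) (z : C) (P Q : Oct) : Prop :=
  @is_series R_AbsRing Oct_NormedModule (fun n => Oscal (Re (Cpow z n)) (a n)) P /\
  @is_series R_AbsRing Oct_NormedModule (fun n => Oscal (Im (Cpow z n)) (a n)) Q.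

Lemma stem_series_at a z P Q J :
  stem_series a z P Q -> imaginary_unit J ->
  power_series_at a (sphere_point z J) (Oplus P (Omult J Q)).
Proof.
intros [HP HQ] HJ. unfold power_series_at.
apply (is_series_Omult_l J) in HQ.
eapply is_series_ext; [|exact (is_series_plus _ _ _ _ HP HQ)].
intros n. cbv beta. rewrite Opow_sphere_point by exact HJ.
change plus with Oplus. unfold sphere_point.
now rewrite Omult_Oplus_l, Omult_Oreal_l, Omult_Oscal_l, Omult_Oscal_r.
Qed.

Lemma Rabs_Re_Cpow z n : Rabs (Re (Cpow z n)) <= Cmod z ^ n.
Proof. rewrite <- Cmod_pow. apply re_le_Cmod. Qed.

Lemma Rabs_Im_Cpow z n : Rabs (Im (Cpow z n)) <= Cmod z ^ n.
Proof.
rewrite <- Cmod_pow. eapply Rle_trans; [apply Rmax_r|apply Rmax_Cmod].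
Qed.

Lemma Oabs_summable_stem r a f z :
  expands_on r a f -> Rbar_lt (Cmod z) r ->
  Oabs_summable (fun n => Oscal (Re (Cpow z n)) (a n)) /\
  Oabs_summable (fun n => Oscal (Im (Cpow z n)) (a n)).
Proof.
intros Hf Hz. split; apply (Oabs_summable_scal r a f (Cmod z));
  auto using Cmod_ge_0, Rabs_Re_Cpow, Rabs_Im_Cpow.
Qed.

Lemma stem_series_ex r a f z :
  expands_on r a f -> Rbar_lt (Cmod z) r -> exists P Q, stem_series a z P Q.
Proof.
intros Hf Hz. destruct (Oabs_summable_stem r a f z Hf Hz) as [HP HQ].
apply Oabs_summable_is_series in HP, HQ.
destruct HP as [P HP], HQ as [Q HQ]. now exists P, Q.
Qed.

Lemma Oscal_sum_n t (a : nat -> Oct) n :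
  Oscal t (@sum_n Oct_NormedModule a n) = @sum_n Oct_NormedModule (fun k => Oscal t (a k)) n.
Proof. symmetry. exact (@sum_n_scal_l R_Ring Oct_NormedModule t a n). Qed.

Lemma Oplus_sum_n (a b : nat -> Oct) n :
  Oplus (@sum_n Oct_NormedModule a n) (@sum_n Oct_NormedModule b n) =
  @sum_n Oct_NormedModule (fun k => Oplus (a k) (b k)) n.
Proof. symmetry. exact (@sum_n_plus Oct_NormedModule a b n). Qed.

Lemma stem_series_convolution r a b f g z P Q P' Q' :
  expands_on r a f -> expands_on r b g -> Rbar_lt (Cmod z) r ->
  stem_series a z P Q -> stem_series b z P' Q' ->
  stem_series (convolution a b) z
    (Oplus (Omult P P') (Oscal (-1) (Omult Q Q')))
    (Oplus (Omult P Q') (Omult Q P')).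
Proof.
intros Hf Hg Hz [HP HQ] [HP' HQ'].
destruct (Oabs_summable_stem r a f z Hf Hz) as [SP SQ].
destruct (Oabs_summable_stem r b g z Hg Hz) as [SP' SQ'].
assert (Hadd : forall n k, (k <= n)%nat -> Cpow z n = Cmult (Cpow z k) (Cpow z (n - k)))
  by (intros n k Hk; rewrite <- Cpow_add_r; f_equal; lia).
split.
- eapply is_series_ext; [|exact (is_series_plus _ _ _ _
    (is_series_Omult _ _ _ _ HP HP' SP SP')
    (is_series_scal _ _ _ (is_series_Omult _ _ _ _ HQ HQ' SQ SQ')))].
  intros n. cbv beta. unfold convolution.
  change scal with Oscal. change plus with Oplus.
  rewrite !Oscal_sum_n, Oplus_sum_n. apply sum_n_ext_loc. intros k Hk.
  rewrite !Omult_Oscal_l, !Omult_Oscal_r, (Hadd n k Hk).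
  apply Oct_ext. intros i. rewrite Ocoord_Oplus, !Ocoord_Oscal. generalize (Cpow z k) (Cpow z (n - k)).
  intros [p q] [p' q']. cbn [Re Im fst snd Cmult]. ring.
- eapply is_series_ext; [|exact (is_series_plus _ _ _ _
    (is_series_Omult _ _ _ _ HP HQ' SP SQ')
    (is_series_Omult _ _ _ _ HQ HP' SQ SP'))].
  intros n. cbv beta. unfold convolution.
  change scal with Oscal. change plus with Oplus.
  rewrite !Oscal_sum_n, Oplus_sum_n. apply sum_n_ext_loc. intros k Hk.
  rewrite !Omult_Oscal_l, !Omult_Oscal_r, (Hadd n k Hk).
  apply Oct_ext. intros i. rewrite Ocoord_Oplus, !Ocoord_Oscal. generalize (Cpow z k) (Cpow z (n - k)).
  intros [p q] [p' q']. cbn [Re Im fst snd Cmult]. ring.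
Qed.

Lemma expands_on_coefficients r f : regular_on r f -> expands_on r (coefficients r f) f.
Proof. apply (epsilon_spec _ (fun a => expands_on r a f)). Qed.

Lemma expands_on_star r f g :
  regular_on r f -> regular_on r g ->
  expands_on r (convolution (coefficients r f) (coefficients r g)) (star r f g).
Proof.
intros Hf Hg w Hw. apply expands_on_coefficients in Hf, Hg.
unfold star, power_series_sum. apply epsilon_spec.
destruct (proj1 (sphereE w w) (sphere_refl w)) as [J [HJ Ew]].
assert (Hz : Rbar_lt (Cmod (Oct_slice w)) r)
  by (rewrite <- (Onorm_sphere w w (sphere_refl w)); exact Hw).
destruct (stem_series_ex _ _ _ _ Hf Hz) as [P [Q HPQ]].
destruct (stem_series_ex _ _ _ _ Hg Hz) as [P' [Q' HPQ']].
eexists. rewrite Ew.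
exact (stem_series_at _ _ _ _ _
  (stem_series_convolution _ _ _ _ _ _ _ _ _ _ Hf Hg Hz HPQ HPQ') HJ).
Qed.

Lemma zero_on_sphereP r a f alpha P Q :
  expands_on r a f -> Rbar_lt (Cmod (Oct_slice alpha)) r ->
  stem_series a (Oct_slice alpha) P Q ->
  (exists w, zero_set r f w /\ sphere alpha w) <-> Odot P P = Odot Q Q /\ Odot P Q = 0.
Proof.
intros Hf Hz HPQ. rewrite <- stem_zeroP.
assert (Hv : forall J, imaginary_unit J ->
  ball_O r (sphere_point (Oct_slice alpha) J) /\
  f (sphere_point (Oct_slice alpha) J) = Oplus P (Omult J Q)).
{ intros J HJ.
  assert (Hb : ball_O r (sphere_point (Oct_slice alpha) J))
    by (unfold ball_O; rewrite Onorm_sphere_point by exact HJ; exact Hz).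
  split; [exact Hb|].
  exact (is_series_Oct_unique _ _ _ (Hf _ Hb) (stem_series_at _ _ _ _ _ HPQ HJ)). }
split.
- intros [w [[_ H0] Hw]]. apply sphereE in Hw. destruct Hw as [J [HJ ->]].
  exists J. split; [exact HJ|]. now rewrite <- (proj2 (Hv J HJ)).
- intros [J [HJ H0]]. exists (sphere_point (Oct_slice alpha) J).
  split; [|apply sphereE; now exists J].
  split; [apply Hv, HJ|]. now rewrite (proj2 (Hv J HJ)).
Qed.

Lemma complex_mult_eq0 p q p' q' :
  p * p' - 4 * q * q' = 0 /\ p * q' + q * p' = 0 <-> p = 0 /\ q = 0 \/ p' = 0 /\ q' = 0.
Proof.
split.
- intros [H1 H2].
  assert (H : (p * p + 4 * (q * q)) * (p' * p' + 4 * (q' * q')) = 0).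
  { transitivity ((p * p' - 4 * q * q') * (p * p' - 4 * q * q')
                  + 4 * ((p * q' + q * p') * (p * q' + q * p'))); [ring|].
    rewrite H1, H2. ring. }
  apply Rmult_integral in H. destruct H as [H|H]; [left|right]; split; nra.
- intros [[-> ->]|[-> ->]]; split; ring.
Qed.

Lemma star_zero_on_sphere r f g alpha :
  regular_on r f -> regular_on r g ->
  (exists w, zero_set r (star r f g) w /\ sphere alpha w) <->
  (exists w, zero_set r f w /\ sphere alpha w) \/
  (exists w, zero_set r g w /\ sphere alpha w).
Proof.
intros Hf Hg.
assert (Hs := expands_on_star r f g Hf Hg). apply expands_on_coefficients in Hf, Hg.
destruct (Rbar_lt_dec (Cmod (Oct_slice alpha)) r) as [Hz|Hz].
- destruct (stem_series_ex _ _ _ _ Hf Hz) as [P [Q HPQ]].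
  destruct (stem_series_ex _ _ _ _ Hg Hz) as [P' [Q' HPQ']].
  rewrite (zero_on_sphereP _ _ _ _ _ _ Hf Hz HPQ), (zero_on_sphereP _ _ _ _ _ _ Hg Hz HPQ').
  rewrite (zero_on_sphereP _ _ _ _ _ _ Hs Hz
    (stem_series_convolution _ _ _ _ _ _ _ _ _ _ Hf Hg Hz HPQ HPQ')).
  destruct (stem_norm_mult P Q P' Q') as [E1 E2]. cbv zeta in E1, E2.
  generalize (complex_mult_eq0 (Odot P P - Odot Q Q) (Odot P Q)
                (Odot P' P' - Odot Q' Q') (Odot P' Q')).
  rewrite <- E1, <- E2.
  assert (K : forall x y, x - y = 0 <-> x = y) by (intros; lra).
  now rewrite !K.
- assert (K : forall h, ~ exists w, zero_set r h w /\ sphere alpha w).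
  { intros h [w [[Hb _] Hw]]. apply Hz. rewrite <- (Onorm_sphere _ _ Hw). exact Hb. }
  split; [|intros [H|H]]; intros; exfalso; eapply K; eassumption.
Qed.

Lemma union_of_spheresE (A : Ensemble Oct) w :
  union_of_spheres A w <-> Inhabited Oct (Intersection Oct A (sphere w)).
Proof.
split.
- intros [alpha [HA Hw]]. exists alpha. split; [exact HA|]. now apply sphere_sym.
- intros [alpha [x HA Hw]]. exists x. split; [exact HA|]. now apply sphere_sym.
Qed.

Theorem corollary8 (r : Rbar) (hr : Rbar_lt 0 r) (f g : Oct -> Oct)
    (hf : regular_on r f) (hg : regular_on r g) :
  Same_set Oct
    (union_of_spheres (zero_set r (star r f g)))
    (union_of_spheres (Union Oct (zero_set r f) (zero_set r g)))
  /\ (forall alpha : Oct,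
        Inhabited Oct
          (Intersection Oct (zero_set r (star r f g)) (sphere alpha))
        <-> Inhabited Oct
          (Intersection Oct (Union Oct (zero_set r f) (zero_set r g))
             (sphere alpha)))
  /\ Included Oct (zero_set r (star r f g))
       (union_of_spheres (Union Oct (zero_set r f) (zero_set r g))).
Proof.
assert (H : forall alpha : Oct,
  Inhabited Oct (Intersection Oct (zero_set r (star r f g)) (sphere alpha)) <->
  Inhabited Oct (Intersection Oct (Union Oct (zero_set r f) (zero_set r g)) (sphere alpha))).
{ intros alpha. generalize (star_zero_on_sphere r f g alpha hf hg). intros [H1 H2]. split.
  - intros [w [w' Hw1 Hw2]]. destruct H1 as [[v [Hv1 Hv2]]|[v [Hv1 Hv2]]].
    + now exists w'.
    + exists v. split; [now left|exact Hv2].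
    + exists v. split; [now right|exact Hv2].
  - intros [w [w' [v Hv|v Hv] Hw]].
    + destruct H2 as [u [Hu1 Hu2]]; [left; now exists v|now exists u].
    + destruct H2 as [u [Hu1 Hu2]]; [right; now exists v|now exists u]. }
split; [|split].
- split; intros w; unfold In; rewrite !union_of_spheresE; apply H.
- exact H.
- intros w Hw. apply union_of_spheresE, H. exists w.
  split; [exact Hw|apply sphere_refl].
Qed.
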